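(* Let $n\ge 2$, let $V=\mathbb{R}^{4n}$ carry a linear quaternionic structure $Q$ and a scalar 2-form $\omega$, let $\mathfrak{g}=\mathfrak{so}^*(2n)\oplus\mathfrak{sp}(1)$, let $\kappa\in\mathbb{R}$ be non-zero, and for $A\in\mathfrak{g}$ let $R^{Q,\omega}_A$ be the associated formal curvature tensor with Ricci tensor $\mathrm{Ric}^{Q,\omega}_A$ (all defined in the context). Then: (1) For $A\in\mathfrak{so}^*(2n)$ the Ricci tensor satisfies $\mathrm{Ric}^{Q,\omega}_A(y,z)=2(n+2)\,\kappa\,\omega(Ay,z)$ for all $y,z\in V$. (2) For $A\in\mathfrak{sp}(1)$ the Ricci tensor satisfies $\mathrm{Ric}^{Q,\omega}_A(y,z)=4n\,\kappa\,\omega(Ay,z)$ for all $y,z\in V$. (3) The Ricci tensor $\mathrm{Ric}^{Q,\omega}_A$ is $Q$-Hermitian if and only if $A\in\mathfrak{so}^*(2n)$. (4) The Ricci tensor $\mathrm{Ric}^{Q,\omega}_A$ is symmetric for any $A\in\mathfrak{so}^*(2n)\oplus\mathfrak{sp}(1)$.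
   Context: A linear quaternionic structure on $V=\mathbb{R}^{4n}$ is a 3-dimensional subspace $Q\subset\mathrm{End}(V)$ spanned by a triple $J_1,J_2,J_3$ (an admissible basis) with $J_1^2=J_2^2=J_3^2=-\mathrm{Id}=J_1J_2J_3$. A scalar 2-form is a non-degenerate skew-symmetric bilinear form $\omega$ on $V$ that is $Q$-Hermitian: $\omega(J_ax,J_ay)=\omega(x,y)$ for $a=1,2,3$. Put $g_a(x,y):=\omega(x,J_ay)$ (a symmetric form). Set $\mathfrak{so}^*(2n):=\{A\in\mathrm{End}(V): \omega(Ax,y)+\omega(x,Ay)=0 \text{ for all } x,y,\ AJ_a=J_aA \text{ for } a=1,2,3\}$, $\mathfrak{sp}(1):=Q$, and $\mathfrak{g}:=\mathfrak{so}^*(2n)\oplus\mathfrak{sp}(1)$, the Lie algebra of $\mathrm{SO}^*(2n)\mathrm{Sp}(1)$. For a fixed non-zero $\kappa\in\mathbb{R}$ and $A\in\mathfrak{g}$, $R^{Q,\omega}_A:\wedge^2V\to\mathfrak{g}$ is $$R^{Q,\omega}_{A}(x,y)z=\kappa\,\omega(x,y)Az+\tfrac{\kappa}{2}\Big(\omega(x,z)Ay-\sum_{a=1}^3g_a(x,z)J_aAy+\omega(Ay,z)x-\sum_{a=1}^3g_a(Ay,z)J_ax\Big)-\tfrac{\kappa}{2}\Big(\omega(y,z)Ax-\sum_{a=1}^3g_a(y,z)J_aAx+\omega(Ax,z)y-\sum_{a=1}^3g_a(Ax,z)J_ay\Big)-\tfrac{\kappa}{2}\sum_{a=1}^3\big(g_a(x,Ay)-g_a(y,Ax)\big)J_az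 .$$ Its Ricci tensor is $\mathrm{Ric}^{Q,\omega}_A(y,z):=\mathrm{Tr}\{x\mapsto R^{Q,\omega}_A(x,y)z\}$. It is called $Q$-Hermitian if $\mathrm{Ric}^{Q,\omega}_A(\mathsf{J}x,\mathsf{J}y)=\mathrm{Ric}^{Q,\omega}_A(x,y)$ for all $x,y\in V$ and all $\mathsf{J}=\mu_1J_1+\mu_2J_2+\mu_3J_3$ with $\mu_1^2+\mu_2^2+\mu_3^2=1$. *)

(* Defs.v *)
From HB Require Import structures.
From mathcomp Require Import all_boot all_order all_algebra.
From mathcomp Require Import sesquilinear reals.

Set Implicit Arguments.
Unset Strict Implicit.
Unset Printing Implicit Defensive.

Import Order.TTheory GRing.Theory Num.Theory.
Local Open Scope ring_scope.

(* R^(4n) is the space of column vectors 'cV[R]_(4 * n), and End(R^(4n)) is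
   'M[R]_(4 * n) acting by [A *m x], so that [*m] is composition in the usual
   order. An admissible basis (J_1, J_2, J_3) is a 3-tuple J indexed from 0. *)

Section ScalarCurvature.
Variables (R : realType) (n : nat).
Local Notation V := 'cV[R]_(4 * n).
Local Notation EndV := 'M[R]_(4 * n).

(* [basis_of Q J] makes Q the span of J and forces \dim Q = 3. *)
Definition admissible_basis (Q : {vspace EndV}) (J : 3.-tuple EndV) : Prop :=
  basis_of Q J /\
  [/\ J`_0 *m J`_0 = - 1%:M, J`_1 *m J`_1 = - 1%:M, J`_2 *m J`_2 = - 1%:M
    & J`_0 *m J`_1 *m J`_2 = - 1%:M].

Definition scalar_2form (J : 3.-tuple EndV) (omega : {skew_symmetric V}) :
    Prop :=
  nondegenerate omega /\
  (forall (a : 'I_3) (x y : V),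
     omega (tnth J a *m x) (tnth J a *m y) = omega x y).

(* so^*(2n) *)
Definition so_star (J : 3.-tuple EndV) (omega : V -> V -> R) (A : EndV) :
    Prop :=
  (forall x y : V, omega (A *m x) y + omega x (A *m y) = 0) /\
  (forall a : 'I_3, A *m tnth J a = tnth J a *m A).

(* so^*(2n) + sp(1), with sp(1) = Q. *)
Definition so_star_sp1 (Q : {vspace EndV}) (J : 3.-tuple EndV)
    (omega : V -> V -> R) (A : EndV) : Prop :=
  exists B C : EndV, [/\ so_star J omega B, C \in Q & A = B + C].

Definition g_form (J : 3.-tuple EndV) (omega : V -> V -> R) (a : 'I_3)
    (x y : V) : R :=
  omega x (tnth J a *m y).

Definition curvature (J : 3.-tuple EndV) (omega : V -> V -> R) (kappa : R)
    (A : EndV) (x y z : V) : V :=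
  let g := g_form J omega in
  (kappa * omega x y) *: (A *m z)
  + (kappa / 2) *:
      (omega x z *: (A *m y)
       - \sum_(a < 3) g a x z *: (tnth J a *m (A *m y))
       + omega (A *m y) z *: x
       - \sum_(a < 3) g a (A *m y) z *: (tnth J a *m x))
  - (kappa / 2) *:
      (omega y z *: (A *m x)
       - \sum_(a < 3) g a y z *: (tnth J a *m (A *m x))
       + omega (A *m x) z *: y
       - \sum_(a < 3) g a (A *m x) z *: (tnth J a *m y))
  - (kappa / 2) *:
      \sum_(a < 3) (g a x (A *m y) - g a y (A *m x)) *: (tnth J a *m z).

(* The trace of a linear map f : V -> V: column j of the matrix below is the
   image under f of the j-th standard basis vector. *)
Definition endo_trace (f : V -> V) : R :=
  \tr (\matrix_(i < 4 * n, j < 4 * n) f (delta_mx j 0) i 0).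

Definition Ric (J : 3.-tuple EndV) (omega : V -> V -> R) (kappa : R)
    (A : EndV) (y z : V) : R :=
  endo_trace (fun x => curvature J omega kappa A x y z).

Definition Q_Hermitian (J : 3.-tuple EndV) (b : V -> V -> R) : Prop :=
  forall mu : 'I_3 -> R, \sum_(a < 3) mu a ^+ 2 = 1 ->
  let JJ := \sum_(a < 3) mu a *: tnth J a in
  forall x y : V, b (JJ *m x) (JJ *m y) = b x y.

End ScalarCurvature.

(* Main.v *)
Require Import Defs.
From HB Require Import structures.
From mathcomp Require Import all_boot all_order all_algebra.
From mathcomp Require Import sesquilinear reals.
From mathcomp Require Import ring.

(* For omega-skew A, tracing the curvature term by term gives
     Ric_A(y,z) = kappa omega(L(A)y, z),
     L(A) = (2n+1) A - sum_a J_a A J_a - (1/2) sum_a tr(J_a A) J_a.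
   If A commutes with the J_a, then the first sum is -3 A and the second is 0,
   since J_a A is conjugated to its opposite by any J_b with b != a. If A is in
   Q, the first sum is A and the second is -4n A. So L is 2(n+2) on so^*(2n)
   and 4n on sp(1). The component B of A = B + C in so^*(2n) contributes a
   Q-Hermitian form; if Ric_A is Q-Hermitian, nondegeneracy of omega makes
   C commute with every J_a, and hence A is in so^*(2n). *)

Set Implicit Arguments.
Unset Strict Implicit.
Unset Printing Implicit Defensive.

Import Order.TTheory GRing.Theory Num.Theory.
Local Open Scope ring_scope.

Lemma col_sum_delta (R : nzRingType) m (v : 'cV[R]_m) :
  v = \sum_i v i 0 *: delta_mx i 0.
Proof.
by rewrite [LHS]matrix_sum_delta; apply: eq_bigr => i _; rewrite big_ord1.
Qed.

(** Since [N] has inverse [- N], conjugation by [N] sends [M] to [- M], so the trace of [M] equals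
    its opposite. *)
Lemma mxtrace_anticomm (F : numFieldType) m (M N : 'M[F]_m) :
  M *m N = - (N *m M) -> N *m N = - 1%:M -> \tr M = 0.
Proof.
move=> MN NN.
have /(congr1 mxtrace) : N *m M *m N = M.
  by rewrite -mulmxA MN mulmxN mulmxA NN mulNmx mul1mx opprK.
rewrite mxtrace_mulC mulmxA NN mulNmx mul1mx raddfN /= => /esym/eqP.
by rewrite -addr_eq0 -mulr2n mulrn_eq0 => /eqP.
Qed.

(** * Traces of maps given as functions on column vectors *)

Section EndoTrace.
Variables (R : realType) (n : nat).
Local Notation V := 'cV[R]_(4 * n).
Local Notation EndV := 'M[R]_(4 * n).

Lemma endo_traceE (f : V -> V) : endo_trace f = \sum_i f (delta_mx i 0) i 0.
Proof. by rewrite /endo_trace /mxtrace; apply: eq_bigr => i _; rewrite mxE. Qed.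

Lemma eq_endo_trace (f g : V -> V) : f =1 g -> endo_trace f = endo_trace g.
Proof. by move=> fg; rewrite !endo_traceE; under eq_bigr do rewrite fg. Qed.

Lemma endo_traceD (f g : V -> V) :
  endo_trace (fun x => f x + g x) = endo_trace f + endo_trace g.
Proof.
by rewrite !endo_traceE -big_split; apply: eq_bigr => i _; rewrite mxE.
Qed.

Lemma endo_traceN (f : V -> V) : endo_trace (fun x => - f x) = - endo_trace f.
Proof. by rewrite !endo_traceE -sumrN; apply: eq_bigr => i _; rewrite mxE. Qed.

Lemma endo_traceZ (c : R) (f : V -> V) :
  endo_trace (fun x => c *: f x) = c * endo_trace f.
Proof.
by rewrite !endo_traceE mulr_sumr; apply: eq_bigr => i _; rewrite mxE.
Qed.

Lemma endo_trace_sum (I : finType) (f : I -> V -> V) :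
  endo_trace (fun x => \sum_a f a x) = \sum_a endo_trace (f a).
Proof.
rewrite endo_traceE; under eq_bigr do rewrite summxE.
by rewrite exchange_big; apply: eq_bigr => a _; rewrite endo_traceE.
Qed.

Lemma endo_trace_mulmx (M : EndV) : endo_trace (fun x => M *m x) = \tr M.
Proof.
by rewrite endo_traceE; apply: eq_bigr => i _; rewrite -colE mxE.
Qed.

(** With phi(x) = omega(M x, w), both sides are the sum of v_i phi(e_i) over the standard basis. *)
Lemma endo_trace_rank1 (omega : {skew_symmetric V}) (M : EndV) (w v : V) :
  endo_trace (fun x => omega (M *m x) w *: v) = omega (M *m v) w.
Proof.
rewrite [v in RHS]col_sum_delta mulmx_sumr linear_sumlz endo_traceE.
by apply: eq_bigr => i _; rewrite -scalemxAr linearZl_LR mxE mulrC.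
Qed.

End EndoTrace.

(** * Nondegenerate skew forms and their infinitesimal isometries *)

Section SkewForm.
Variables (F : numFieldType) (m : nat) (omega : {skew_symmetric 'cV[F]_m}).

Lemma skewC x y : omega x y = - omega y x.
Proof. by rewrite hermC expr1 mulN1r. Qed.

Hypothesis omega_nondeg : nondegenerate omega.

Lemma nondegenerate_eq0 (x : 'cV[F]_m) : (forall y, omega x y = 0) -> x = 0.
Proof.
move=> x0; apply/eqP; rewrite -memv0 -(eqP omega_nondeg).
by apply/mem_orthovP => y _.
Qed.

Lemma nondegenerate_mx_inj (A B : 'M[F]_m) :
  (forall x y, omega (A *m x) y = omega (B *m x) y) -> A = B.
Proof.
move=> AB; apply/eqP; rewrite -subr_eq0; apply/eqP/matrixP=> i j.
have : (A - B) *m delta_mx j 0 = 0 :> 'cV_m.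
  by apply: nondegenerate_eq0 => y; rewrite mulmxBl linearBl /= AB subrr.
by rewrite -colE => /colP/(_ i); rewrite !mxE.
Qed.

(** In terms of the Gram matrix [W] of omega, skewness reads A^T W = - W A. As [W] is invertible,
    A^T is similar to - A, and it has the same trace as A. *)
Lemma mxtrace_skew (A : 'M[F]_m) :
  (forall x y, omega (A *m x) y + omega x (A *m y) = 0) -> \tr A = 0.
Proof.
move=> skA.
pose W : 'M_m := \matrix_(i, j) omega (delta_mx i 0) (delta_mx j 0).
(* A row vector killed by [W] is, transposed, omega-orthogonal to every basis vector, hence zero. *)
have W_unit : W \in unitmx.
  rewrite -row_free_unit; apply: inj_row_free => v vW0.
  rewrite -[v]trmxK [v^T]nondegenerate_eq0 ?trmx0 // => y.
  rewrite [y]col_sum_delta linear_sumr big1 //= => j _; rewrite linearZr_LR /=.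
  have -> : omega v^T (delta_mx j 0) = (v *m W) 0 j.
    rewrite [v^T]col_sum_delta linear_sumlz mxE.
    by apply: eq_bigr => i _; rewrite linearZl_LR /= !mxE.
  by rewrite vW0 mxE mulr0.
have AW : A^T *m W = - (W *m A).
  apply/matrixP => i j; rewrite !mxE; apply/eqP; rewrite -addr_eq0.
  apply/eqP; rewrite -[RHS](skA (delta_mx i 0) (delta_mx j 0)).
  rewrite (col_sum_delta (A *m delta_mx i 0)).
  rewrite (col_sum_delta (A *m delta_mx j 0)).
  rewrite linear_sumlz linear_sumr /=.
  by congr (_ + _); apply: eq_bigr => k _;
    rewrite -colE !mxE (linearZl_LR, linearZr_LR) //= mulrC.
have : \tr (A^T *m W *m invmx W) = \tr A by rewrite mulmxK // mxtrace_tr.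
rewrite AW mulNmx raddfN /= mxtrace_mulC mulKmx // => /esym/eqP.
by rewrite -addr_eq0 -mulr2n mulrn_eq0 => /eqP.
Qed.

End SkewForm.

(** Cancelling K on the right and I on the left of I J K = - 1 gives I J = K and J K = I. The rest
    of the multiplication table follows from these. *)
Lemma quaternion_anticomm (R : nzRingType) m (I J K : 'M[R]_m) :
  I *m I = - 1%:M -> J *m J = - 1%:M -> K *m K = - 1%:M ->
  I *m J *m K = - 1%:M ->
  [/\ I *m J = - (J *m I), J *m K = - (K *m J) & K *m I = - (I *m K)].
Proof.
move=> II JJ KK IJK.
have IJ : I *m J = K.
  apply: oppr_inj; rewrite -[I *m J]mulmx1 -mulmxN -KK mulmxA IJK.
  by rewrite mulNmx mul1mx.
have JK : J *m K = I.
  apply: oppr_inj; rewrite -[J *m K]mul1mx -mulNmx -II -mulmxA.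
  by rewrite [I *m (J *m K)]mulmxA IJK mulmxN mulmx1.
have JI : J *m I = - K by rewrite -JK mulmxA JJ mulNmx mul1mx.
have KJ : K *m J = - I by rewrite -IJ -mulmxA JJ mulmxN mulmx1.
have IK : I *m K = - J by rewrite -IJ mulmxA II mulNmx mul1mx.
have KI : K *m I = J by rewrite -JK mulmxA KJ mulNmx IK opprK.
by rewrite IJ JI JK KJ KI IK !opprK.
Qed.

(** Supplies the [J_b] anticommuting with [J_a] that makes traces vanish. *)
Lemma ord3_neq (a : 'I_3) : exists b : 'I_3, a != b.
Proof. by case: a => -[|[|[|]]] // ?; [exists 1 | exists 0 | exists 0]. Qed.

(** * Algebra of an admissible basis and of its span *)

Section QuaternionicStructure.
Variables (R : realType) (n : nat).
Local Notation V := 'cV[R]_(4 * n).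
Local Notation EndV := 'M[R]_(4 * n).
Variables (Q : {vspace EndV}) (J : 3.-tuple EndV).
Hypothesis hJ : admissible_basis Q J.
Local Notation "J_[ a ]" := (tnth J a) (format "J_[ a ]").

Lemma admissible_sqr (a : 'I_3) : J_[a] *m J_[a] = - 1%:M.
Proof.
have [_ [J00 J11 J22 _]] := hJ.
by case: a => -[|[|[|]]] // lt3; rewrite (tnth_nth 0).
Qed.

Lemma admissible_anticomm (a b : 'I_3) :
  a != b -> J_[a] *m J_[b] = - (J_[b] *m J_[a]).
Proof.
have [_ [J00 J11 J22 J012]] := hJ.
have [J01 J12 J20] := quaternion_anticomm J00 J11 J22 J012.
by case: a b => -[|[|[|]]] // ? [[|[|[|]]] // ?] _;
  rewrite !(tnth_nth 0) /= ?J01 ?J12 ?J20 ?opprK.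
Qed.

Lemma admissible_mxtrace (a : 'I_3) : \tr J_[a] = 0.
Proof.
have [b neq_ab] := ord3_neq a.
exact: mxtrace_anticomm (admissible_anticomm neq_ab) (admissible_sqr b).
Qed.

Lemma sp1_sqr (mu : 'I_3 -> R) :
  (\sum_a mu a *: J_[a]) *m (\sum_a mu a *: J_[a])
    = - (\sum_a mu a ^+ 2) *: 1%:M.
Proof.
set S := LHS.
have SE : S = \sum_a \sum_b (mu a * mu b) *: (J_[a] *m J_[b]).
  rewrite /S mulmx_suml; apply: eq_bigr => a _; rewrite mulmx_sumr.
  by apply: eq_bigr => b _; rewrite -scalemxAl -scalemxAr scalerA.
have SE' : S = \sum_a \sum_b (mu a * mu b) *: (J_[b] *m J_[a]).
  rewrite SE exchange_big; apply: eq_bigr => a _; apply: eq_bigr => b _.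
  by rewrite mulrC.
have two_neq0 : 2 != 0 :> R by rewrite pnatr_eq0.
(* The square is doubled and one copy has its indices swapped, so that each off-diagonal term
   becomes a multiple of J_a J_b + J_b J_a = 0. *)
apply: (scalerI two_neq0).
rewrite [in LHS]scaler_nat mulr2n {1}SE SE' -big_split /= -sumrN scaler_suml.
rewrite scaler_sumr; apply: eq_bigr => a _.
rewrite -big_split (bigD1 a) //= big1 => [|b ne_ba]; last first.
  by rewrite admissible_anticomm 1?eq_sym // scalerN addNr.
by rewrite addr0 admissible_sqr -expr2 -mulr2n scaler_nat scalerN scaleNr.
Qed.

(** This and [trace_part] are the two sums over a in the operator L. *)
Definition sandwich (A : EndV) : EndV := \sum_a J_[a] *m A *m J_[a].
Definition trace_part (A : EndV) : EndV := \sum_a \tr (J_[a] *m A) *: J_[a].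

Lemma sandwichD A B : sandwich (A + B) = sandwich A + sandwich B.
Proof.
by rewrite -big_split; apply: eq_bigr => a _; rewrite mulmxDr mulmxDl.
Qed.

Lemma sandwichZ c A : sandwich (c *: A) = c *: sandwich A.
Proof.
rewrite scaler_sumr; apply: eq_bigr => a _.
by rewrite -scalemxAr -scalemxAl.
Qed.

Lemma trace_partD A B : trace_part (A + B) = trace_part A + trace_part B.
Proof.
by rewrite -big_split; apply: eq_bigr => a _; rewrite mulmxDr raddfD scalerDl.
Qed.

Lemma trace_partZ c A : trace_part (c *: A) = c *: trace_part A.
Proof.
rewrite scaler_sumr; apply: eq_bigr => a _.
by rewrite -scalemxAr mxtraceZ scalerA.
Qed.

Lemma sandwich_commuting A :
  (forall a, A *m J_[a] = J_[a] *m A) -> sandwich A = - 3 *: A.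
Proof.
move=> AJ; rewrite /sandwich.
under eq_bigr do rewrite -AJ -mulmxA admissible_sqr mulmxN mulmx1.
by rewrite sumr_const card_ord scaleNr scaler_nat mulNrn.
Qed.

Lemma trace_part_commuting A :
  (forall a, A *m J_[a] = J_[a] *m A) -> trace_part A = 0.
Proof.
move=> AJ; rewrite /trace_part big1 // => a _.
have [b neq_ab] := ord3_neq a.
rewrite (mxtrace_anticomm _ (admissible_sqr b)) ?scale0r //.
by rewrite -mulmxA AJ mulmxA (admissible_anticomm neq_ab) mulNmx -mulmxA.
Qed.

(** The term a = b gives - J_b, and each of the two others gives J_b by anticommutation. *)
Lemma sandwich_basis b : sandwich J_[b] = J_[b].
Proof.
rewrite /sandwich (bigD1 b) //= admissible_sqr mulNmx mul1mx.
rewrite (eq_bigr (fun=> J_[b])) => [|a ne_ab]; last first.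
  rewrite admissible_anticomm // mulNmx -mulmxA admissible_sqr.
  by rewrite mulmxN mulmx1 opprK.
by rewrite sumr_const cardC1 card_ord mulr2n addrA addNr add0r.
Qed.

(** Only a = b survives, with tr(J_b J_b) = - 4n; for a != b, J_a J_b anticommutes with J_b and is
    traceless. *)
Lemma trace_part_basis b : trace_part J_[b] = - (4 * n)%:R *: J_[b].
Proof.
rewrite /trace_part (bigD1 b) //= admissible_sqr raddfN /= mxtrace1.
rewrite big1 ?addr0 // => a ne_ab.
rewrite (mxtrace_anticomm _ (admissible_sqr b)) ?scale0r //.
by rewrite {1}admissible_anticomm // mulNmx -mulmxA.
Qed.

Lemma sandwich_sp1 C : C \in Q -> sandwich C = C.
Proof.
case: hJ => /coord_basis basisJ _ /basisJ ->.
rewrite {1}/sandwich; under eq_bigr do rewrite mulmx_sumr mulmx_suml.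
rewrite exchange_big; apply: eq_bigr => b _.
by rewrite -[LHS]/(sandwich _) sandwichZ -tnth_nth sandwich_basis.
Qed.

Lemma trace_part_sp1 C : C \in Q -> trace_part C = - (4 * n)%:R *: C.
Proof.
case: hJ => /coord_basis basisJ _ /basisJ ->; rewrite scaler_sumr.
rewrite {1}/trace_part.
under eq_bigr do rewrite mulmx_sumr raddf_sum /= scaler_suml.
rewrite exchange_big; apply: eq_bigr => b _.
rewrite -[LHS]/(trace_part _) trace_partZ -tnth_nth trace_part_basis.
by rewrite !scalerA mulrC.
Qed.

(** * The scalar 2-form and the Ricci tensor of the formal curvature *)

Section ScalarForm.
Variable omega : {skew_symmetric V}.
Hypothesis homega : scalar_2form J omega.

Lemma scalar_form_invariant a x y : omega (J_[a] *m x) (J_[a] *m y) = omega x y.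
Proof. by case: homega. Qed.

Lemma scalar_form_skew a x y : omega (J_[a] *m x) y = - omega x (J_[a] *m y).
Proof.
rewrite -(scalar_form_invariant a) mulmxA admissible_sqr mulNmx mul1mx.
by rewrite linearNl.
Qed.

Lemma sp1_skew C x y :
  C \in Q -> omega (C *m x) y + omega x (C *m y) = 0.
Proof.
case: hJ => /coord_basis basisJ _ /basisJ ->.
rewrite !mulmx_suml linear_sumlz linear_sumr -big_split big1 //= => b _.
rewrite -!scalemxAl linearZl_LR linearZr_LR /= -tnth_nth scalar_form_skew.
by rewrite mulrN addNr.
Qed.

(** The unit combination lies in Q, so it is omega-skew, and it squares to - 1; moving it across
    omega gives the invariance. *)
Lemma sp1_unit_invariant (mu : 'I_3 -> R) x y : \sum_a mu a ^+ 2 = 1 ->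
  omega ((\sum_a mu a *: J_[a]) *m x) ((\sum_a mu a *: J_[a]) *m y)
    = omega x y.
Proof.
move=> mu1; set JJ := \sum_a _.
have QJJ : JJ \in Q.
  apply: memv_suml => a _; rewrite memvZ //.
  by case: hJ => /basis_mem -> //; rewrite mem_tnth.
apply/eqP; rewrite -subr_eq0 -(sp1_skew x (JJ *m y) QJJ) mulmxA sp1_sqr mu1.
by rewrite scaleN1r mulNmx mul1mx linearNr.
Qed.

Variable kappa : R.

(** As a function of x, each summand of the curvature is a scalar multiple of x, of a fixed matrix
    applied to x, or of a fixed vector with coefficient omega(M x, w). Each kind has a known
    trace. *)
Lemma RicE A y z :
  Ric J omega kappa A y z =
  kappa * omega (A *m z) y
  + kappa / 2 * (omega (A *m y) z
      - \sum_a omega (J_[a] *m (A *m y)) (J_[a] *m z)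
      + omega (A *m y) z * (4 * n)%:R
      - \sum_a omega (A *m y) (J_[a] *m z) * \tr J_[a])
  - kappa / 2 * (omega y z * \tr A
      - \sum_a omega y (J_[a] *m z) * \tr (J_[a] *m A)
      + omega (A *m y) z
      - \sum_a omega (A *m (J_[a] *m y)) (J_[a] *m z))
  - kappa / 2 * \sum_a (omega (J_[a] *m z) (J_[a] *m (A *m y))
      + omega (J_[a] *m A *m (J_[a] *m z)) y).
Proof.
have tr_form w v : endo_trace (fun x => omega x w *: v) = omega v w.
  rewrite -[v in RHS]mul1mx -endo_trace_rank1.
  by apply: eq_endo_trace => x; rewrite mul1mx.
have tr_id : endo_trace (fun x : V => x) = (4 * n)%:R.
  rewrite -mxtrace1 -endo_trace_mulmx.
  by apply: eq_endo_trace => x; rewrite mul1mx.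
rewrite /Ric /curvature /g_form.
(* The summands are put in these shapes; in the last sum, - omega(y, J_a A x) becomes omega(J_a A x,
   y). *)
rewrite (@eq_endo_trace _ _ _ (fun x =>
  kappa *: (omega x y *: (A *m z))
  + (kappa / 2) *: (omega x z *: (A *m y)
      - \sum_a omega x (J_[a] *m z) *: (J_[a] *m (A *m y))
      + omega (A *m y) z *: x
      - \sum_a omega (A *m y) (J_[a] *m z) *: (J_[a] *m x))
  - (kappa / 2) *: (omega y z *: (A *m x)
      - \sum_a omega y (J_[a] *m z) *: (J_[a] *m A *m x)
      + omega (A *m x) z *: y
      - \sum_a omega (A *m x) (J_[a] *m z) *: (J_[a] *m y))
  - (kappa / 2) *: \sum_a (omega x (J_[a] *m (A *m y)) *: (J_[a] *m z)
      + omega (J_[a] *m A *m x) y *: (J_[a] *m z)))); last first.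
  move=> x; rewrite scalerA.
  have -> : \sum_a omega y (J_[a] *m z) *: (J_[a] *m A *m x) =
            \sum_a omega y (J_[a] *m z) *: (J_[a] *m (A *m x)).
    by apply: eq_bigr => a _; rewrite mulmxA.
  have -> // : \sum_a (omega x (J_[a] *m (A *m y)) *: (J_[a] *m z)
                 + omega (J_[a] *m A *m x) y *: (J_[a] *m z)) =
    \sum_a (omega x (J_[a] *m (A *m y)) - omega y (J_[a] *m (A *m x)))
            *: (J_[a] *m z).
  apply: eq_bigr => a _; rewrite -scalerDl -(mulmxA _ A x).
  by rewrite (skewC _ (J_[a] *m (A *m x))).
rewrite !(endo_traceD, endo_traceN, endo_traceZ, endo_trace_sum).
rewrite !tr_form tr_id endo_trace_mulmx endo_trace_rank1.
do ![congr (_ + _) | congr (- _) | congr (_ * _)];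
  apply: eq_bigr => a _;
  by rewrite ?endo_traceD ?endo_traceZ ?tr_form ?endo_trace_rank1
             ?endo_trace_mulmx.
Qed.

Lemma Ric_skew A y z :
  (forall x x', omega (A *m x) x' + omega x (A *m x') = 0) ->
  Ric J omega kappa A y z =
  kappa * omega
    (((2 * n%:R + 1) *: A - sandwich A - 2^-1 *: trace_part A) *m y) z.
Proof.
move=> skA; rewrite RicE (mxtrace_skew homega.1 skA).
have AN x x' : omega (A *m x) x' = - omega x (A *m x').
  by apply/eqP; rewrite -addr_eq0 skA.
have E1 : \sum_a omega (J_[a] *m (A *m y)) (J_[a] *m z) = 3 * omega (A *m y) z.
  under eq_bigr do rewrite scalar_form_invariant.
  by rewrite sumr_const card_ord mulr_natl.
have E2 : \sum_a omega (A *m y) (J_[a] *m z) * \tr J_[a] = 0.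
  by rewrite big1 // => a _; rewrite admissible_mxtrace mulr0.
have E3 : \sum_a omega y (J_[a] *m z) * \tr (J_[a] *m A) =
          - omega (trace_part A *m y) z.
  rewrite mulmx_suml linear_sumlz -sumrN; apply: eq_bigr => a _.
  by rewrite -scalemxAl linearZl_LR /= scalar_form_skew mulrN opprK mulrC.
have E4 : \sum_a omega (A *m (J_[a] *m y)) (J_[a] *m z) =
          - omega (sandwich A *m y) z.
  rewrite mulmx_suml linear_sumlz -sumrN; apply: eq_bigr => a _.
  by rewrite /= -!mulmxA scalar_form_skew opprK.
have E5 : \sum_a (omega (J_[a] *m z) (J_[a] *m (A *m y))
            + omega (J_[a] *m A *m (J_[a] *m z)) y) =
          - 3 * omega (A *m y) z + omega (sandwich A *m y) z.
  rewrite big_split /=; congr (_ + _).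
    under eq_bigr do rewrite scalar_form_invariant skewC.
    by rewrite sumr_const card_ord mulNr mulr_natl mulNrn.
  rewrite mulmx_suml linear_sumlz; apply: eq_bigr => a _.
  by rewrite /= -!mulmxA scalar_form_skew AN opprK scalar_form_skew skewC opprK.
(* Up to kappa, omega(A y, z) collects 1 + (4n - 2)/2 - 1/2 + 3/2 = 2n + 1, the sandwich term - 1/2
   - 1/2 = - 1, and the trace term - 1/2. *)
rewrite E1 E2 E3 E4 E5 !mulmxBl !linearBl /= -!scalemxAl !linearZl_LR /=.
rewrite (AN z y) (skewC _ z) natrM.
by field.
Qed.

(** The constants are (2n + 1) + 3 = 2(n + 2) on B and (2n + 1) - 1 + 2n = 4n on C. *)
Lemma Ric_so_star_sp1 B C y z : so_star J omega B -> C \in Q ->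
  Ric J omega kappa (B + C) y z =
  kappa * (2 * (n%:R + 2) * omega (B *m y) z + 4 * n%:R * omega (C *m y) z).
Proof.
move=> [skB BJ] QC; rewrite Ric_skew => [|x x']; last first.
  by rewrite !mulmxDl linearDl linearDr addrACA skB sp1_skew ?addr0.
rewrite sandwichD trace_partD sandwich_commuting // trace_part_commuting //.
rewrite sandwich_sp1 // trace_part_sp1 // add0r !mulmxBl !linearBl /=.
rewrite mulmxDl linearDl /= -!scalemxAl !linearZl_LR /= !mulmxDl !linearDl /=.
rewrite natrM.
by field.
Qed.

End ScalarForm.

End QuaternionicStructure.

Theorem corollary2p7 (R : realType) (n : nat) (hn : (2 <= n)%N)
    (Q : {vspace 'M[R]_(4 * n)}) (J : 3.-tuple 'M[R]_(4 * n))
    (hJ : admissible_basis Q J)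
    (omega : {skew_symmetric 'cV[R]_(4 * n)}) (homega : scalar_2form J omega)
    (kappa : R) (hkappa : kappa != 0) :
  [/\ forall A : 'M[R]_(4 * n), so_star J omega A ->
        forall y z : 'cV[R]_(4 * n),
          Ric J omega kappa A y z = 2 * (n%:R + 2) * kappa * omega (A *m y) z,
      forall A : 'M[R]_(4 * n), A \in Q ->
        forall y z : 'cV[R]_(4 * n),
          Ric J omega kappa A y z = 4 * n%:R * kappa * omega (A *m y) z,
      forall A : 'M[R]_(4 * n), so_star_sp1 Q J omega A ->
        (Q_Hermitian J (Ric J omega kappa A) <-> so_star J omega A)
    & forall A : 'M[R]_(4 * n), so_star_sp1 Q J omega A ->
        forall y z : 'cV[R]_(4 * n),
          Ric J omega kappa A y z = Ric J omega kappa A z y].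
Proof.
(* The first two assertions are the cases C = 0 and B = 0 of [Ric_so_star_sp1]. *)
have Ric_so A : so_star J omega A -> forall y z,
    Ric J omega kappa A y z = 2 * (n%:R + 2) * kappa * omega (A *m y) z.
  move=> soA y z; rewrite -[A in LHS]addr0 (Ric_so_star_sp1 hJ) ?mem0v //.
  by rewrite mul0mx linear0l; ring.
split=> //.
- move=> A QA y z; rewrite -[A in LHS]add0r (Ric_so_star_sp1 hJ) //.
    by rewrite mul0mx linear0l; ring.
  split=> [x x'|a]; last by rewrite mulmx0 mul0mx.
  by rewrite !mul0mx linear0l linear0r addr0.
- move=> _ [B [C [soB QC ->]]]; have [skB BJ] := soB.
  split=> [ricH|soBC mu mu1 JJ x y].
    split=> [x y|a].
      rewrite !mulmxDl linearDl linearDr addrACA skB.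
      by rewrite (sp1_skew hJ homega) ?addr0.
    rewrite mulmxDl mulmxDr BJ; congr (_ + _).
    (* Indicator coefficients specialize the Hermitian condition to the single structure J_a. *)
    have mu1 : \sum_b (a == b)%:R ^+ 2 = 1 :> R.
      rewrite (bigD1 a) //= eqxx expr1n big1 ?addr0 // => b /negPf nba.
      by rewrite eq_sym nba expr0n.
    have JaE : \sum_b (a == b)%:R *: tnth J b = tnth J a.
      rewrite (bigD1 a) //= eqxx scale1r big1 ?addr0 // => b /negPf nba.
      by rewrite eq_sym nba scale0r.
    (* The B-terms on both sides agree because B commutes with J_a; they cancel, and so do the
       nonzero factors kappa and 4n. *)
    have CJ x y :
        omega (C *m (tnth J a *m x)) (tnth J a *m y) = omega (C *m x) y.
      have := ricH _ mu1 x y; rewrite JaE !(Ric_so_star_sp1 hJ) //.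
      move=> /(mulfI hkappa).
      rewrite (mulmxA B) BJ -mulmxA (scalar_form_invariant homega).
      move=> /addrI/mulfI; apply.
      by rewrite -natrM pnatr_eq0 -lt0n muln_gt0 /= (leq_trans _ hn).
    (* [CJ] at x and J_a y, with J_a J_a = - 1, gives omega(C x, J_a y) = - omega(C J_a x, y), while
       the left side is - omega(J_a C x, y). *)
    apply: (nondegenerate_mx_inj homega.1) => x y; apply: oppr_inj.
    rewrite -!mulmxA (scalar_form_skew hJ homega) -[in RHS]CJ.
    rewrite (mulmxA (tnth J a)) (admissible_sqr hJ) mulNmx mul1mx.
    by rewrite linearNr opprK.
  (* Conversely, B + C commutes with every unit combination of the J_a, and omega is invariant under
     it. *)
  rewrite !Ric_so //; congr (_ * _); have [_ AJ] := soBC.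
  rewrite -(sp1_unit_invariant hJ homega _ y mu1) !mulmxA.
  congr (omega (_ *m _) _).
  rewrite mulmx_sumr mulmx_suml; apply: eq_bigr => a _.
  by rewrite -scalemxAr -scalemxAl AJ.
- move=> _ [B [C [soB QC ->]]] y z; rewrite !(Ric_so_star_sp1 hJ homega) //.
  (* For omega-skew A, the form omega(A y, z) is symmetric; both B and C are omega-skew. *)
  have sym_form A : (forall x x', omega (A *m x) x' + omega x (A *m x') = 0) ->
      omega (A *m y) z = omega (A *m z) y.
    by move=> /(_ y z)/eqP; rewrite addr_eq0 -skewC => /eqP.
  rewrite (sym_form B soB.1) (sym_form C) // => x x'.
  exact: (sp1_skew hJ homega).
Qed.
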